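(* Let $g$ be a $\mathbb{Z}_2^2$-symmetric Lorentzian metric on $\mathbb{H}_3$ such that the component of the corresponding grading of $\mathfrak{h}_3$ which contains the center is degenerate. Then $g$ can be reduced, by an automorphism of $\mathfrak{h}_3$, to the form $$g=\omega_1^2+\omega_3^2-(\omega_2-\omega_3)^2.$$
   Context: $\mathbb{H}_3$ is the Heisenberg group of real upper triangular unipotent $3\times3$ matrices. Its Lie algebra $\mathfrak{h}_3$ has basis $X_1,X_2,X_3$ with $[X_1,X_2]=X_3$, $[X_1,X_3]=[X_2,X_3]=0$ (so the center is $\mathbb{R}X_3$); $\{\omega_1,\omega_2,\omega_3\}$ is the dual basis, also viewed as left-invariant 1-forms on $\mathbb{H}_3$. A Lorentzian metric on $\mathbb{H}_3$ here means a left-invariant one, i.e. it is given by a non-degenerate symmetric bilinear form $B$ on $\mathfrak{h}_3$ of signature $(2,1)$ (two positive, one negative). A $\mathbb{Z}_2^2$-symmetric structure on $\mathbb{H}_3$ is given by a $\mathbb{Z}_2^2$-grading $\mathfrak{h}_3=\bigoplus_{\gamma\in\mathbb{Z}_2^2}\mathfrak{g}_\gamma$, $[\mathfrak{g}_\gamma,\mathfrak{g}_{\gamma'}]\subset\mathfrak{g}_{\gamma\gamma'}$, with $\mathfrak{g}_e=\{0\}$ for the identity $e$ of $\mathbb{Z}_2^2$. The metric $g$ is called $\mathbb{Z}_2^2$-symmetric Lorentzian (with respect to such a structure) if one of the following holds: (1) the nontrivial components $\mathfrak{g}_\gamma$ are orthogonal and non-degenerate with respect to $B$; (2) one nontrivial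 component $\mathfrak{g}_{\lambda_0}$ is degenerate, the other components are orthogonal and non-degenerate, and there exists a component $\mathfrak{g}_{\lambda_1}$ such that the restriction of $B$ to $\mathfrak{g}_{\lambda_0}\oplus\mathfrak{g}_{\lambda_1}$ has signature $(1,1)$. A component is degenerate if the restriction of $B$ to it is degenerate. ''Reduced by an automorphism to a form'' means that the form is obtained from $B$ by pulling back along an automorphism of the Lie algebra $\mathfrak{h}_3$. *)

(* Defs.v *)
From HB Require Import structures.
From mathcomp Require Import all_boot all_order all_algebra.
From mathcomp Require Import reals.
Import Order.TTheory GRing.Theory Num.Theory.

Set Implicit Arguments.
Unset Strict Implicit.
Unset Printing Implicit Defensive.

Local Open Scope ring_scope.

Section BilinearForms.
Variables (R : realType) (vT : vectType R).
Implicit Types (B : {symmetric vT}) (V W : {vspace vT}).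

Definition orthogonal_spaces B V W : bool := (V <= orthov B W)%VS.

Definition nondegenerate_on B V : bool := (V :&: orthov B V == 0)%VS.

Definition degenerate_on B V : bool := ~~ nondegenerate_on B V.

(* (p, q): p positive and q negative squares, no null direction. *)
Definition signature_on B V (p q : nat) : Prop :=
  exists e : (p + q).-tuple vT,
    [/\ basis_of V e,
        forall i j : 'I_(p + q), i != j -> B (tnth e i) (tnth e j) = 0,
        forall i : 'I_(p + q), (i < p)%N -> 0 < B (tnth e i) (tnth e i)
      & forall i : 'I_(p + q), (p <= i)%N -> B (tnth e i) (tnth e i) < 0].

End BilinearForms.

(* The group Z_2^2, written additively: its identity e is 0. *)
Notation Z22 := ('Z_2 * 'Z_2)%type.

Section Heisenberg.
Variable R : realType.

(* The row vector (a1, a2, a3) stands for a1 X_1 + a2 X_2 + a3 X_3. *)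
Definition h3 : vectType R := 'rV[R]_3.

Definition X3 : h3 := delta_mx 0 2.

Definition omega1 (x : h3) : R := (x : 'rV[R]_3) 0 0.
Definition omega2 (x : h3) : R := (x : 'rV[R]_3) 0 1.
Definition omega3 (x : h3) : R := (x : 'rV[R]_3) 0 2.

(* The bilinear alternating extension of [X_1, X_2] = X_3,
   [X_1, X_3] = [X_2, X_3] = 0. *)
Definition bracket (x y : h3) : h3 :=
  (omega1 x * omega2 y - omega2 x * omega1 y) *: X3.

Definition central (z : h3) : Prop := forall x, bracket z x = 0.

Definition h3_automorphism (f : 'End(h3)) : Prop :=
  bijective f /\ forall x y, f (bracket x y) = bracket (f x) (f y).

(* A left-invariant metric is identified with its value on the Lie algebra. *)
Definition lorentzian_metric (B : {symmetric h3}) : Prop :=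
  nondegenerate B /\ signature_on B fullv 2 1.

Definition Z22_grading (g : Z22 -> {vspace h3}) : Prop :=
  [/\ (\sum_(c : Z22) g c)%VS = fullv,
      directv (\sum_(c : Z22) g c)%VS
    & forall (c c' : Z22) (x y : h3),
        x \in g c -> y \in g c' -> bracket x y \in g (c + c')].

Definition Z22_symmetric_structure (g : Z22 -> {vspace h3}) : Prop :=
  Z22_grading g /\ g 0 = 0%VS.

Definition Z22_symmetric_lorentzian
    (g : Z22 -> {vspace h3}) (B : {symmetric h3}) : Prop :=
  [/\ forall c c' : Z22, c != 0 -> c' != 0 -> c != c' ->
        orthogonal_spaces B (g c) (g c')
    & forall c : Z22, c != 0 -> nondegenerate_on B (g c)]
  \/
  exists l0 : Z22,
    [/\ l0 != 0,
        degenerate_on B (g l0),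
        forall c c' : Z22, c != 0 -> c' != 0 -> c != l0 -> c' != l0 ->
          c != c' -> orthogonal_spaces B (g c) (g c'),
        forall c : Z22, c != 0 -> c != l0 -> nondegenerate_on B (g c)
      & exists l1 : Z22,
          [/\ l1 != 0, l1 != l0 & signature_on B (g l0 + g l1)%VS 1 1]].

End Heisenberg.

(* Main.v *)
Require Import Defs.
From HB Require Import structures.
From mathcomp Require Import all_boot all_order all_algebra.
From mathcomp Require Import reals.
From mathcomp Require Import ring lra.
Import Order.TTheory GRing.Theory Num.Theory.

(** The grading forces the component of the center to be the line of [X3]: for
    [w] in it and [x] in another component [g d], [[w, x]] is a multiple of [X3]
    lying in both [g c] and [g (c + d)], hence zero, so [w] is central.  As that
    line is degenerate, [X3] is null.  A Lorentzian form with [X3] null has a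
    unique normal form: choose [w] and [u] with [w] orthogonal to [X3] (hence
    spacelike) and [u] not, make [u] orthogonal to [w], rescale [w] and [u] so
    that [B e1 e1 = B e2 [e1, e2] = 1], and add a multiple of [X3] to [e2] to
    make [B e2 e2 = -1]. *)

Set Implicit Arguments.
Unset Strict Implicit.
Unset Printing Implicit Defensive.

Local Open Scope ring_scope.

(** * Symmetric forms and null vectors in signature (2,1) *)

Lemma symC (R : realType) (vT : vectType R) (B : {symmetric vT}) x y :
  B x y = B y x.
Proof. by rewrite [LHS]hermC expr0 mul1r. Qed.

Lemma symDl (R : realType) (vT : vectType R) (B : {symmetric vT}) x y z :
  B (x + y) z = B x z + B y z.
Proof. exact: linearDl. Qed.

Lemma symZl (R : realType) (vT : vectType R) (B : {symmetric vT}) a x z :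
  B (a *: x) z = a * B x z.
Proof. exact: linearZl_LR. Qed.

Lemma symDr (R : realType) (vT : vectType R) (B : {symmetric vT}) x y z :
  B x (y + z) = B x y + B x z.
Proof. exact: linearDr. Qed.

Lemma symZr (R : realType) (vT : vectType R) (B : {symmetric vT}) a x z :
  B x (a *: z) = a * B x z.
Proof. exact: linearZr_LR. Qed.

Definition symE := (@symDl, @symDr, @symZl, @symZr).

(** If [B w w <= 0], then [B] is nonpositive on the span of [n] and [w]. This span meets the
    positive plane of the first two basis vectors, and a vector in the intersection must vanish,
    which makes [w] a multiple of [n]. *)
Lemma null_orthogonal_pos (R : realType) (vT : vectType R)
    (B : {symmetric vT}) (V : {vspace vT}) (n w : vT) :
  signature_on B V 2 1 -> n \in V -> w \in V ->
  n != 0 -> B n n = 0 -> B w n = 0 -> w \notin <[n]>%VS -> 0 < B w w.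
Proof.
case=> e [eb eo ep en] nV wV n0 nn wn wnn; rewrite ltNge; apply/negP => ww.
have expand v : v \in V -> exists a b c : R,
    v = a *: tnth e 0 + b *: tnth e 1 + c *: tnth e 2.
  move=> vV; exists (coord e 0 v), (coord e 1 v), (coord e 2 v).
  rewrite {1}(coord_basis eb vV) !big_ord_recl big_ord0 addr0 addrA.
  by rewrite !(tnth_nth 0); congr (_ *: _ + _ *: _ + _ *: _);
     congr (coord _ _ _); apply/val_inj.
have P0 : 0 < B (tnth e 0) (tnth e 0) by apply: ep.
have P1 : 0 < B (tnth e 1) (tnth e 1) by apply: ep.
have o01 : B (tnth e 0) (tnth e 1) = 0 by apply: eo.
have o10 : B (tnth e 1) (tnth e 0) = 0 by apply: eo.
have pos0 (a b : R) (y := a *: tnth e 0 + b *: tnth e 1) :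
    B y y <= 0 -> y = 0.
  rewrite /y !symE /= o01 o10 => h.
  have sq_ge0 k l : 0 < l -> 0 <= k ^+ 2 * l :> R.
    by move=> l0; rewrite mulr_ge0 ?sqr_ge0 ?ltW.
  have sq_le0 k l : 0 < l -> k ^+ 2 * l <= 0 -> k = 0 :> R.
    move=> l0; rewrite pmulr_lle0 // real_exprn_even_le0 ?num_real //=.
    exact: eqP.
  have := sq_ge0 a _ P0; have := sq_ge0 b _ P1 => hb ha.
  have -> : a = 0 by apply: (sq_le0 _ _ P0); lra.
  have -> : b = 0 by apply: (sq_le0 _ _ P1); lra.
  by rewrite !scale0r addr0.
have [x0 [x1 [x2 nE]]] := expand n nV.
have [a0 [a1 [a2 wE]]] := expand w wV.
(* Otherwise [n] would be a nonzero null vector in the positive definite plane. *)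
have x2N : x2 != 0.
  apply/eqP => x20; move: n0; rewrite nE x20 scale0r addr0.
  rewrite pos0 ?eqxx //.
  by move: nn; rewrite {1 2}nE x20 scale0r addr0 => ->.
(* This combination cancels the negative basis vector; its square is [x2 ^+ 2 * B w w], since [n] is
   null and orthogonal to [w]. *)
have yE : x2 *: w - a2 *: n = (x2 * a0 - a2 * x0) *: tnth e 0
                             + (x2 * a1 - a2 * x1) *: tnth e 1.
  rewrite {1}wE {1}nE !scalerDr !scalerA opprD addrACA (mulrC a2 x2).
  by rewrite subrr addr0 opprD addrACA -!scalerBl.
have y0 : x2 *: w - a2 *: n = 0.
  rewrite yE; apply: pos0; rewrite -yE -scaleNr !symE /= nn (symC B n w) wn.
  nra.
case/negP: wnn; apply/vlineP; exists (x2^-1 * a2).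
by rewrite -scalerA -(subr0_eq y0) scalerK.
Qed.

(** * The center of the Heisenberg algebra and its gradings *)

Section HeisenbergAlgebra.
Variable R : realType.
Implicit Types (x y z : h3 R).

Lemma h3P x y :
  omega1 x = omega1 y -> omega2 x = omega2 y -> omega3 x = omega3 y -> x = y.
Proof.
move=> h1 h2 h3; apply/rowP => i.
case: i => [[|[|[|//]]] ilt].
- by rewrite (_ : Ordinal ilt = 0) //; apply: val_inj.
- by rewrite (_ : Ordinal ilt = 1) //; apply: val_inj.
- by rewrite (_ : Ordinal ilt = 2) //; apply: val_inj.
Qed.

Lemma omega1D x y : omega1 (x + y) = omega1 x + omega1 y.
Proof. exact: mxE. Qed.
Lemma omega2D x y : omega2 (x + y) = omega2 x + omega2 y.
Proof. exact: mxE. Qed.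
Lemma omega3D x y : omega3 (x + y) = omega3 x + omega3 y.
Proof. exact: mxE. Qed.
Lemma omega1Z a x : omega1 (a *: x) = a * omega1 x.
Proof. exact: mxE. Qed.
Lemma omega2Z a x : omega2 (a *: x) = a * omega2 x.
Proof. exact: mxE. Qed.
Lemma omega3Z a x : omega3 (a *: x) = a * omega3 x.
Proof. exact: mxE. Qed.

Lemma omega1_X3 : omega1 (X3 R) = 0.
Proof. by rewrite /omega1 /X3 mxE. Qed.
Lemma omega2_X3 : omega2 (X3 R) = 0.
Proof. by rewrite /omega2 /X3 mxE. Qed.
Lemma omega3_X3 : omega3 (X3 R) = 1.
Proof. by rewrite /omega3 /X3 mxE. Qed.

Definition omegaE := (omega1D, omega2D, omega3D, omega1Z, omega2Z, omega3Z,
  omega1_X3, omega2_X3, omega3_X3).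

Definition h3vec (a b c : R) : h3 R :=
  \row_(j < 3) [:: a; b; c]`_j.

Lemma omega1_vec a b c : omega1 (h3vec a b c) = a. Proof. exact: mxE. Qed.
Lemma omega2_vec a b c : omega2 (h3vec a b c) = b. Proof. exact: mxE. Qed.
Lemma omega3_vec a b c : omega3 (h3vec a b c) = c. Proof. exact: mxE. Qed.
Definition vecE := (omega1_vec, omega2_vec, omega3_vec).

Lemma X3_neq0 : X3 R != 0.
Proof.
apply/eqP => h; have := omega3_X3; rewrite h /omega3 mxE => /esym/eqP.
by rewrite oner_eq0.
Qed.

Lemma bracketDr x y z : bracket x (y + z) = bracket x y + bracket x z.
Proof. by rewrite /bracket !omegaE -scalerDl; congr (_ *: _); ring. Qed.

Lemma X3_central : central (X3 R).
Proof. by move=> x; rewrite /bracket !omegaE !mul0r subrr scale0r. Qed.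

Lemma central_line z : central z -> z \in <[X3 R]>%VS.
Proof.
move=> zc; apply/vlineP; exists (omega3 z).
(* Brackets with X_2 and X_1 read off [omega1 z] and [- omega2 z]. *)
have := congr1 (@omega3 R) (zc (h3vec 0 1 0)).
have := congr1 (@omega3 R) (zc (h3vec 1 0 0)).
rewrite /bracket !omegaE !vecE /omega3 [(0 : 'rV__) _ _]mxE -/(omega3 z).
by move=> h2 h1; apply: h3P; rewrite !omegaE; lra.
Qed.

Lemma graded_center (g : Z22 -> {vspace h3 R}) (c : Z22) :
  Z22_symmetric_structure g -> X3 R \in g c -> (g c <= <[X3 R]>)%VS.
Proof.
move=> [[gT gD gB] g0] Xc; apply/subvP => w wc; apply: central_line => x.
have : x \in (\sum_(d : Z22) g d)%VS by rewrite gT memvf.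
case/memv_sumP => xs xsg ->.
have br0 : bracket w 0 = 0.
  by rewrite /bracket /omega1 /omega2 !mxE !mulr0 subrr scale0r.
rewrite (big_morph (bracket w) (bracketDr w) br0) big1 // => d _.
(* Only [d = 0] gives [c + d = c], and that term vanishes because [g 0] is zero. For the other [d],
   directness of the sum separates [g c] from [g (c + d)]. *)
have [d0|dN] := eqVneq d 0.
  have := xsg d isT; rewrite d0 g0 memv0 => /eqP ->; exact: br0.
have bcd := gB c d _ _ wc (xsg d isT).
have bc : bracket w (xs d) \in g c by apply: memvZ.
have cd : c + d != c by rewrite -subr_eq0 addrC addKr.
have := directv_sumP gD c isT => h.
apply/eqP; rewrite -memv0 -h memv_cap bc /=.
by apply: (subvP (sumv_sup (c + d) _ (subvv _))).
Qed.

End HeisenbergAlgebra.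

(** * Frames adapted to the normal form *)

Section NullCenter.
Variables (R : realType) (B : {symmetric (h3 R)}) (e1 e2 e3 : h3 R).

(** The candidate automorphism: it sends X_1, X_2, X_3 to [e1], [e2], [e3]. *)
Definition frame_fun (x : h3 R) : h3 R :=
  omega1 x *: e1 + omega2 x *: e2 + omega3 x *: e3.

Lemma frame_fun_is_linear : linear frame_fun.
Proof.
move=> a x y; rewrite /frame_fun !omegaE !scalerDl !scalerDr !scalerA.
by rewrite [X in X + _ = _]addrACA [LHS]addrACA.
Qed.

HB.instance Definition _ :=
  GRing.isLinear.Build R (h3 R) (h3 R) *:%R frame_fun frame_fun_is_linear.

Hypotheses (B11 : B e1 e1 = 1) (B12 : B e1 e2 = 0) (B13 : B e1 e3 = 0)
           (B22 : B e2 e2 = -1) (B23 : B e2 e3 = 1) (B33 : B e3 e3 = 0)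
           (e12 : bracket e1 e2 = e3) (e3c : e3 \in <[X3 R]>%VS).

(** The target quadratic form expands to omega1^2 - omega2^2 + 2 omega2 omega3, and the assumed
    values of [B] are its Gram matrix. *)
Lemma frame_form x y :
  B (frame_fun x) (frame_fun y) =
    omega1 x * omega1 y + omega3 x * omega3 y
    - (omega2 x - omega3 x) * (omega2 y - omega3 y).
Proof.
rewrite /frame_fun !symE (symC B e2 e1) (symC B e3 e1) (symC B e3 e2).
rewrite B11 B12 B13 B22 B23 B33; ring.
Qed.

(** Injectivity follows from nondegeneracy of the pulled-back form: a kernel vector pairs to zero
    with X_1, X_2, X_3. Brackets are preserved because [e3] is central and equals the bracket of
    [e1] and [e2]. *)
Lemma frame_automorphism : h3_automorphism (linfun frame_fun).
Proof.
have inj : lker (linfun frame_fun) == 0%VS.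
  rewrite -subv0; apply/subvP => x; rewrite memv_ker lfunE memv0 /= => /eqP x0.
  have form0 y : omega1 x * omega1 y + omega3 x * omega3 y
      - (omega2 x - omega3 x) * (omega2 y - omega3 y) = 0.
    by rewrite -frame_form x0 -(scale0r 0) symZl mul0r.
  have := form0 (h3vec 1 0 0); have := form0 (h3vec 0 1 0).
  have := form0 (h3vec 0 0 1); rewrite !vecE => h3 h2 h1.
  apply/eqP/h3P; rewrite /omega1 /omega2 /omega3 [RHS]mxE
    -/(omega1 x) -/(omega2 x) -/(omega3 x); lra.
split; first by exists (linfun frame_fun)^-1%VF;
  [exact: lker0_lfunK|exact: lker0_lfunVK].
move=> x y; rewrite !lfunE /=.
have /vlineP[k e3E] := e3c.
have := congr1 (@omega3 R) e12.
rewrite /frame_fun e3E /bracket !omegaE => h12.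
rewrite !mulr0 !scale0r !add0r !mulr1 !addr0 scalerA in h12 *.
by congr (_ *: _); rewrite -h12; ring.
Qed.

End NullCenter.

(** * Construction of the adapted frame *)

Lemma null_center_normal_form (R : realType) (B : {symmetric (h3 R)}) :
  lorentzian_metric B -> B (X3 R) (X3 R) = 0 ->
  exists f : 'End(h3 R),
    h3_automorphism f /\
    forall x y : h3 R,
      B (f x) (f y) =
        omega1 x * omega1 y + omega3 x * omega3 y
        - (omega2 x - omega3 x) * (omega2 y - omega3 y).
Proof.
move=> [nd sg] B33.
pose p := B (h3vec 1 0 0) (X3 R); pose q := B (h3vec 0 1 0) (X3 R).
have BX x : B x (X3 R) = omega1 x * p + omega2 x * q.
  have {1}-> : x = omega1 x *: h3vec 1 0 0 + omega2 x *: h3vec 0 1 0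
                 + omega3 x *: X3 R.
    by apply: h3P; rewrite !omegaE !vecE; ring.
  by rewrite !symE B33 mulr0 addr0.
(* [N] is positive, as otherwise [X3] would lie in the radical of [B]. *)
pose N := p ^+ 2 + q ^+ 2.
have N0 : 0 < N.
  rewrite lt_def addr_ge0 ?sqr_ge0 // andbT paddr_eq0 ?sqr_ge0 // !sqrf_eq0.
  apply/negP => /andP[/eqP p0 /eqP q0].
  have : X3 R \in orthov B fullv.
    by apply/mem_orthovP => v _; rewrite symC BX p0 q0 !mulr0 addr0.
  by rewrite (eqP nd) memv0 (negbTE (X3_neq0 R)).
(* [w] spans, together with [X3], the orthogonal of [X3]; the choice of [u] gives
   [bracket w u = N *: X3]. *)
pose w := h3vec q (- p) 0; pose u := h3vec p q 0.
have BwX : B w (X3 R) = 0 by rewrite BX !vecE; ring.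
have BuX : B u (X3 R) = N by rewrite BX !vecE /N; ring.
have ww : 0 < B w w.
  apply: (null_orthogonal_pos sg (memvf (X3 R)) (memvf w)) => //.
    exact: X3_neq0.
  apply/negP => /vlineP[k wE].
  have := congr1 (@omega1 R) wE; have := congr1 (@omega2 R) wE.
  rewrite !omegaE !vecE !mulr0 => /eqP; rewrite oppr_eq0 => /eqP p0 q0.
  by move: N0; rewrite /N p0 q0 expr0n addr0 ltxx.
(* With e1 = w/s and e2 equal to k times the part of u orthogonal to w, modulo X3, the bracket is
   (kN/s) X3. Requiring its product with e2 to be 1 means k^2 N^2 = s, so k = r/N with r^2 = s. *)
pose s := Num.sqrt (B w w); pose r := Num.sqrt s.
have s0 : 0 < s by rewrite sqrtr_gt0.
have r0 : 0 < r by rewrite sqrtr_gt0.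
have s2 : B w w = s ^+ 2 by rewrite sqr_sqrtr ?ltW.
have r2 : s = r ^+ 2 by rewrite sqr_sqrtr ?ltW.
have sN : s != 0 by rewrite gt_eqF.
have rN : r != 0 by rewrite gt_eqF.
have NN : N != 0 by rewrite gt_eqF.
pose h := (r / N) *: (u + (- (B u w / B w w)) *: w).
have BhX : B h (X3 R) = r by rewrite !symE BwX BuX mulr0 addr0 divfK.
have Bwh : B w h = 0.
  by rewrite !symE (symC B w u) mulNr divfK ?subrr ?mulr0 // gt_eqF.
(* Solves [B h h + 2 * t * r = -1], the condition [B e2 e2 = -1]. *)
pose t := (-1 - B h h) / (2 * r).
pose e1 := s^-1 *: w; pose e2 := h + t *: X3 R; pose e3 := r^-1 *: X3 R.
have B11 : B e1 e1 = 1 by rewrite !symE s2 expr2 mulKf ?mulVf.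
have B12 : B e1 e2 = 0.
  by rewrite /e1 /e2 symZl symDr (symZr _ t) Bwh BwX mulr0 addr0 mulr0.
have B13 : B e1 e3 = 0 by rewrite !symE BwX !mulr0.
have B22 : B e2 e2 = -1.
  rewrite /e2 symDl (symDr _ h) (symDr _ (t *: _)) !(symZl _ t) !(symZr _ t).
  rewrite (symC B (X3 R) h) BhX B33 /t; field.
  exact: rN.
have B23 : B e2 e3 = 1.
  rewrite /e2 /e3 symDl (symZl _ t) !(symZr _ r^-1) BhX B33.
  by rewrite !mulr0 addr0 mulVf.
have B33' : B e3 e3 = 0 by rewrite /e3 symZl symZr B33 !mulr0.
have e12 : bracket e1 e2 = e3.
  rewrite /bracket /e3; congr (_ *: _).
  rewrite !omegaE !vecE r2 /N; field.
  by apply/and3P; split=> //; rewrite gt_eqF.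
have e3c : e3 \in <[X3 R]>%VS by rewrite memvZ ?memv_line.
exists (linfun (frame_fun e1 e2 e3)); split.
  exact: (@frame_automorphism R B).
by move=> x y; rewrite !lfunE; apply: frame_form.
Qed.

Theorem proposition5p3 (R : realType)
    (B : {symmetric (h3 R)}) (g : Z22 -> {vspace (h3 R)}) (c : Z22)
    (Blor : lorentzian_metric B)
    (gsym : Z22_symmetric_structure g)
    (Bsym : Z22_symmetric_lorentzian g B)
    (c_center : forall z : h3 R, central z -> z \in g c)
    (c_degenerate : degenerate_on B (g c)) :
  exists f : 'End(h3 R),
    h3_automorphism f /\
    forall x y : h3 R,
      B (f x) (f y) =
        omega1 x * omega1 y + omega3 x * omega3 y
        - (omega2 x - omega3 x) * (omega2 y - omega3 y).
Proof.
apply: null_center_normal_form => //.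
have gcX := graded_center gsym (c_center _ (@X3_central R)).
(* Degeneracy provides a nonzero [z = k *: X3] orthogonal to itself, so [X3] is null. *)
move: c_degenerate; rewrite /degenerate_on /nondegenerate_on -subv0.
case/subvPn => z; rewrite memv_cap memv0 => /andP[zg zo] z0.
have /vlineP[k zE] := subvP gcX _ zg.
have := mem_orthovP zo z zg; rewrite zE symZl symZr => /eqP.
rewrite !mulf_eq0; have [k0|_] := eqVneq k 0; last by rewrite !orFb => /eqP.
by move: z0; rewrite zE k0 scale0r eqxx.
Qed.
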